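(* Consider the gauging measurement procedure for a logical operator $L$ in a qLDPC code with checks $\{s_i\}$, with a choice of connected auxiliary graph $G$. If the following desiderata are satisfied, then $G$ is a suitable graph, i.e. the resulting deformed code is LDPC and has code distance at least that of the original code. 1. The graph $G$ is sparse, i.e. has constant degree. 2. The matchings $\mu_i$ for all checks $s_i$ are of constant size, and any edge qubit is in no more than a constant number of these matchings. 3. There is a generating set of constant-weight cycles for $G$ such that any edge is in a constant number of cycles from the generating set. 4. The graph $G$ is sufficiently expanding in the sense that its Cheeger constant satisfies $h(G)\ge 1$.
   Context: Codes and asymptotics. A stabilizer code is specified by commuting Pauli checks $\{s_i\}$ generating a group not containing $-\mathbb 1$. Its distance is the minimum weight of a Pauli operator that commutes with all checks but is not, up to phase, a product of checks. ''qLDPC''/''LDPC'' refers to a family of codes whose checks have weight bounded by a constant and in which each qubit is acted on by at most a constant number of checks; ''constant'' means bounded uniformly over the family (codes, operators $L$, graphs $G$). A logical operator $L$ is a Pauli operator commuting with all checks; bases are chosen per qubit so that $L=\prod_{v\in\mathrm{supp}(L)}X_v$. The $Z$-type support of a Pauli operator is the set of qubits on which it acts by $Y$ or $Z$. Auxiliary graph and deformed code. $G=(V,E)$ is a connected graph whose vertex set contains the qubits of $\mathrm{supp}(L)$; any additional vertices are called dummy vertices and carry no qubit. One auxiliary qubit is placed on each edge. The deformed code is the stabilizer code on the original qubits together with the edge qubits with the following checks (signs of the $A_v$ are given by measurement outcomes and are irrelevant here): - $A_v=X_v\prod_{e\ni v}X_e$ for non-dummy $v\in V$, and $A_v=\prod_{e\ni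 v}X_e$ for dummy $v\in V$; - $B_p=\prod_{e\in p}Z_e$ for $p$ in a chosen generating set of cycles of $G$ (generating the $\mathbb Z_2$ cycle space); - $\tilde s_i=s_i\prod_{e\in\mu_i}Z_e$ for every original check $s_i$, where the ''perfect matching'' $\mu_i\subseteq E$ is a chosen set of edges whose $\mathbb Z_2$-boundary is the (even-sized) set of vertices given by the intersection of the $Z$-type support of $s_i$ with $\mathrm{supp}(L)$. The Cheeger constant is $h(G)=\min_{S}|\delta S|/|S|$, the minimum over nonempty $S\subseteq V$ with $|S|\le |V|/2$, where $\delta S$ is the set of edges with exactly one endpoint in $S$. A suitable graph for $L$ is a connected graph $G$ for which the deformed code is LDPC and has code distance at least that of the original code. *)

(* Defs.v *)
(* Minima over possibly empty sets are taken in [\bar rat], so as to be +oo on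
   the empty set. *)
From HB Require Import structures.
From mathcomp Require Import all_boot all_order all_algebra all_fingroup.
From mathcomp Require Import constructive_ereal.

Set Implicit Arguments.
Unset Strict Implicit.
Unset Printing Implicit Defensive.

Import Order.TTheory GRing.Theory Num.Theory.
Local Open Scope ring_scope.

Section SymDiff.
Variable T : finType.

Definition symdiff (A B : {set T}) : {set T} :=
  [set x | (x \in A) (+) (x \in B)].

Lemma in_symdiff x A B : (x \in symdiff A B) = (x \in A) (+) (x \in B).
Proof. by rewrite inE. Qed.

Lemma symdiffA : associative symdiff.
Proof. by move=> A B C; apply/setP=> x; rewrite !inE addbA. Qed.

Lemma symdiff0s : left_id set0 symdiff.
Proof. by move=> A; apply/setP=> x; rewrite !inE. Qed.

Lemma symdiffss A : symdiff A A = set0.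
Proof. by apply/setP=> x; rewrite !inE addbb. Qed.

End SymDiff.

(* [Pauli k a b] stands for i^k * prod_(q in a) X_q * prod_(q in b) Z_q, the
   X factors standing on the left. In particular Y_q = i X_q Z_q is
   [Pauli 1 [set q] [set q]], and Z_q X_q = - X_q Z_q gives the phase
   2 #|b :&: a'| in the product of (k, a, b) and (k', a', b'). *)
Record pauli (Q : finType) := Pauli {
  phase : 'Z_4;
  xsupp : {set Q};
  zsupp : {set Q}
}.
Arguments Pauli {Q}.

Section PauliGroup.
Variable Q : finType.

Definition pauli_to_prod (P : pauli Q) := (phase P, xsupp P, zsupp P).
Definition pauli_of_prod (t : 'Z_4 * {set Q} * {set Q}) :=
  Pauli t.1.1 t.1.2 t.2.

Lemma pauli_to_prodK : cancel pauli_to_prod pauli_of_prod.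
Proof. by case. Qed.

HB.instance Definition _ := Finite.copy (pauli Q) (can_type pauli_to_prodK).

Definition swap_phase (b a : {set Q}) : 'Z_4 := (2 * #|b :&: a|)%:R.

Lemma swap_phaseE b a :
  swap_phase b a = \sum_q (2 * ((q \in b) && (q \in a)))%:R.
Proof.
rewrite /swap_phase -natr_sum -big_distrr /= -sum1_card big_mkcond /=.
by congr (2 * _)%:R; apply: eq_bigr => q _; rewrite inE; case: andP.
Qed.

Definition pauli_one : pauli Q := Pauli 0 set0 set0.

Definition pauli_mul (P P' : pauli Q) : pauli Q :=
  Pauli (phase P + phase P' + swap_phase (zsupp P) (xsupp P'))
        (symdiff (xsupp P) (xsupp P'))
        (symdiff (zsupp P) (zsupp P')).

Definition pauli_inv (P : pauli Q) : pauli Q :=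
  Pauli (- phase P - swap_phase (zsupp P) (xsupp P)) (xsupp P) (zsupp P).

Lemma pauli_mulA : associative pauli_mul.
Proof.
move=> [k a b] [k' a' b'] [k'' a'' b'']; rewrite /pauli_mul /= !symdiffA.
congr Pauli.
suff -> : swap_phase (symdiff b b') a'' =
    swap_phase b a'' + swap_phase b' a''.
  suff -> : swap_phase b (symdiff a' a'') =
      swap_phase b a' + swap_phase b a''.
    by rewrite !addrA [LHS](ACl (1*2*5*3*6*4)).
  rewrite !swap_phaseE -big_split /=; apply: eq_bigr => q _; rewrite inE.
  by case: (q \in b); case: (q \in a'); case: (q \in a''); apply/val_inj.
rewrite !swap_phaseE -big_split /=; apply: eq_bigr => q _; rewrite inE.
by case: (q \in b); case: (q \in b'); case: (q \in a''); apply/val_inj.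
Qed.

Lemma pauli_mul1 : left_id pauli_one pauli_mul.
Proof.
move=> [k a b]; rewrite /pauli_mul /= !symdiff0s.
by rewrite /swap_phase set0I cards0 muln0 add0r addr0.
Qed.

Lemma pauli_mulV : left_inverse pauli_one pauli_inv pauli_mul.
Proof.
move=> [k a b]; rewrite /pauli_mul /= !symdiffss; congr Pauli.
by rewrite addrAC subrK addNr.
Qed.

HB.instance Definition _ :=
  Finite_isGroup.Build (pauli Q) pauli_mulA pauli_mul1 pauli_mulV.

Definition supp (P : pauli Q) : {set Q} := xsupp P :|: zsupp P.
Definition weight (P : pauli Q) : nat := #|supp P|.

Definition Xop (A : {set Q}) : pauli Q := Pauli 0 A set0.
Definition Zop (A : {set Q}) : pauli Q := Pauli 0 set0 A.

(* (-1)^s times the identity *)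
Definition sgn (s : bool) : pauli Q := Pauli (if s then 2 else 0) set0 set0.

Definition phases : {set pauli Q} := [set Pauli k set0 set0 | k : 'Z_4].

End PauliGroup.
Arguments sgn {Q}.
Arguments phases {Q}.

Definition pauli_inl (Q Q' : finType) (P : pauli Q) : pauli (Q + Q')%type :=
  Pauli (phase P) (inl @: xsupp P) (inl @: zsupp P).

Record pauli_code := PauliCode {
  qubit : finType;
  check_idx : finType;
  check : check_idx -> pauli qubit
}.

Section Codes.
Variable C : pauli_code.
Local Open Scope group_scope.

Definition checks : {set pauli (qubit C)} := [set check j | j : check_idx C].

Definition is_stabilizer_code : Prop :=
  (forall j k : check_idx C, commute (check j) (check k)) /\
  sgn true \notin <<checks>>.

Definition nontrivial_logical (P : pauli (qubit C)) : bool :=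
  (P \in 'C(checks)) && (P \notin phases * <<checks>>).

(* +oo when there is no nontrivial logical operator *)
Definition distance : \bar rat :=
  (\big[mine/+oo]_(P : pauli (qubit C) | nontrivial_logical P)
     (weight P)%:R%:E)%E.

Definition checks_on (q : qubit C) : {set check_idx C} :=
  [set j | q \in supp (check j)].

End Codes.

Definition LDPC (I : Type) (C : I -> pauli_code) : Prop :=
  (forall i, is_stabilizer_code (C i)) /\
  exists K : nat, forall i,
    (forall j : check_idx (C i), (weight (check j) <= K)%N) /\
    (forall q : qubit (C i), (#|checks_on q| <= K)%N).

(* Loopless; parallel edges are allowed, a simple graph being the case where
   [ends] is injective. *)
Record graph (V : finType) := Graph {
  edge : finType;
  ends : edge -> {set V};
  card_ends : forall e, #|ends e| = 2%N
}.

Section Graphs.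
Variables (V : finType) (G : graph V).

Definition star (v : V) : {set edge G} := [set e | v \in ends e].

Definition adjacent : rel V :=
  fun v w => [exists e : edge G, (v \in ends e) && (w \in ends e)].

Definition connected : Prop := forall v w : V, connect adjacent v w.

Definition boundary (F : {set edge G}) : {set V} :=
  [set v | odd #|F :&: star v|].

(* A cycle is an element of the Z_2 cycle space. *)
Definition is_cycle (F : {set edge G}) : bool := boundary F == set0.

Definition generates_cycles (B : {set {set edge G}}) : Prop :=
  (forall p, p \in B -> is_cycle p) /\
  (forall F, is_cycle F ->
     exists2 J : {set {set edge G}}, J \subset B &
       F = \big[@symdiff (edge G)/set0]_(p in J) p).

Definition cut (S : {set V}) : {set edge G} :=
  [set e | #|ends e :&: S| == 1%N].

(* +oo when #|V| <= 1, there being no admissible S *)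
Definition cheeger : \bar rat :=
  (\big[mine/+oo]_(S : {set V} | (0 < #|S|)%N && (2 * #|S| <= #|V|)%N)
     (#|cut S|%:R / #|S|%:R)%R%:E)%E.

End Graphs.

(* The vertices are the qubits of the support of L together with dummies. *)
Definition vertices (Q : finType) (A : {set Q}) (D : finType) : finType :=
  ({q : Q | q \in A} + D)%type.

Definition real_vertices (Q : finType) (A : {set Q}) (D : finType)
    (B : {set Q}) : {set vertices A D} :=
  [set v : vertices A D | if v is inl u then val u \in B else false].

Record gauging (C : pauli_code) := Gauging {
  lsupp : {set qubit C};
  logical_L : Xop lsupp \in 'C(checks C)%g;
  dummy : finType;
  aux : graph (vertices lsupp dummy);
  aux_connected : connected aux;
  cycles : {set {set edge aux}};
  cycles_generate : generates_cycles cycles;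
  matching : check_idx C -> {set edge aux};
  matching_boundary : forall j,
    boundary (matching j) = real_vertices lsupp dummy (zsupp (check j));
  (* [outcome v] holds when measuring A_v gave -1. *)
  outcome : vertices lsupp dummy -> bool;
  (* The product of the signed A_v is s L, s being the product of the outcomes.
     This value of L can occur unless - s L is a product of checks; otherwise
     the deformed checks would generate -1. *)
  outcome_possible :
    (sgn (~~ \big[addb/false]_v outcome v) * Xop lsupp \notin <<checks C>>)%g
}.

Section Deformed.
Variables (C : pauli_code) (g : gauging C).

Let V : finType := vertices (lsupp g) (dummy g).
Let E : finType := edge (aux g).

Definition deformed_qubit : finType := (qubit C + E)%type.

Definition vertex_check (v : V) : pauli deformed_qubit :=
  (sgn (outcome v) *
   match v with
   | inl u => Xop (inl (val u) |: [set inr e | e in star (aux g) v])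
   | inr _ => Xop [set inr e | e in star (aux g) v]
   end)%g.

Definition cycle_check (p : {set E}) : pauli deformed_qubit :=
  Zop [set inr e | e in p].

Definition matched_check (j : check_idx C) : pauli deformed_qubit :=
  (pauli_inl E (check j) * Zop [set inr e | e in matching g j])%g.

Definition deformed : pauli_code :=
  @PauliCode deformed_qubit
    (V + {p : {set E} | p \in cycles g} + check_idx C)%type
    (fun c => match c with
              | inl (inl v) => vertex_check v
              | inl (inr p) => cycle_check (val p)
              | inr j => matched_check j
              end).

End Deformed.

Section Families.
Variables (I : Type) (C : I -> pauli_code) (g : forall i, gauging (C i)).

Definition constant_degree : Prop :=
  exists K : nat, forall i (v : vertices (lsupp (g i)) (dummy (g i))),
    (#|star (aux (g i)) v| <= K)%N.

Definition constant_matchings : Prop :=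
  exists K : nat, forall i,
    (forall j, (#|matching (g i) j| <= K)%N) /\
    (forall e, (#|[set j | e \in matching (g i) j]| <= K)%N).

Definition constant_cycles : Prop :=
  exists K : nat, forall i,
    (forall p, p \in cycles (g i) -> (#|p| <= K)%N) /\
    (forall e, (#|[set p in cycles (g i) | e \in p]| <= K)%N).

Definition suitable : Prop :=
  [/\ forall i, connected (aux (g i)),
      LDPC (fun i => deformed (g i)) &
      forall i, (distance (C i) <= distance (deformed (g i)))%E].

End Families.

(* Main.v *)
(* Modulo phases, an element of the deformed stabilizer group is determined by a
   set S of vertices (the product of the A_v over S has edge part the cut of S),
   an element T of the original stabilizer group, and a set F of edges whose
   boundary is the Z-type support of T on L. An X pattern on the edges is
   annihilated by all cycles iff it is a cut, because the row space of the
   incidence matrix over F_2 is the annihilator of its kernel. Hence a logical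
   operator P of the deformed code, multiplied by the A_v over a suitable S, has
   no X on the edges, and its part on the original qubits is a logical operator
   P0 of the original code, which is nontrivial if P is. As S may be replaced by
   its complement, expansion lets us take |S| at most the size of its cut: the
   weight gained on supp L is at most the X weight lost on the edges. *)
Require Import Defs.
From mathcomp Require Import all_boot all_order all_algebra all_fingroup.
From mathcomp Require Import constructive_ereal.
From mathcomp Require Import zify.

(** * Parity of overlaps *)

(** The standard bilinear form on indicator vectors over F_2, with [symdiff] as addition. *)
Definition overlap {T : finType} (A B : {set T}) : bool := odd #|A :&: B|.

Section Parity.
Import GRing.Theory.
Local Open Scope ring_scope.
Variable T : finType.
Implicit Types A B : {set T}.

Lemma overlapE A B : overlap A B = \big[addb/false]_x ((x \in A) && (x \in B)).
Proof.
rewrite /overlap -sum1_card (big_morph odd oddD (erefl (odd 0))) big_mkcond /=.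
by apply: eq_bigr => x _; rewrite inE; case: ifP.
Qed.

Lemma overlapC A B : overlap A B = overlap B A.
Proof. by rewrite /overlap setIC. Qed.

Lemma overlap_symdiffr A B B' :
  overlap A (symdiff B B') = overlap A B (+) overlap A B'.
Proof.
rewrite !overlapE -big_split /=; apply: eq_bigr => x _.
by rewrite in_symdiff andb_addr.
Qed.

Lemma overlap_symdiffl A A' B :
  overlap (symdiff A A') B = overlap A B (+) overlap A' B.
Proof. by rewrite overlapC overlap_symdiffr !(overlapC B). Qed.

Lemma overlap0s A : overlap set0 A = false.
Proof. by rewrite /overlap set0I cards0. Qed.

Lemma overlaps0 A : overlap A set0 = false.
Proof. by rewrite overlapC overlap0s. Qed.

Lemma overlap1s x A : overlap [set x] A = (x \in A).
Proof.
rewrite /overlap; have [xA|xA] := boolP (x \in A).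
  by rewrite (setIidPl _) ?sub1set // cards1.
by rewrite (disjoint_setI0 _) ?cards0 // disjoints1.
Qed.

Lemma natr_overlap A B :
  (overlap A B)%:R = \sum_x (x \in A)%:R * (x \in B)%:R :> 'F_2.
Proof.
rewrite overlapE.
rewrite (big_morph (fun b : bool => b%:R : 'F_2) (id1 := 0) (op1 := +%R)) //=.
  by apply: eq_bigr => x _; case: (_ \in A); case: (_ \in B); apply/val_inj.
by case=> [] [] //=; apply/val_inj.
Qed.

End Parity.

(** * Overlaps along injections; row spaces over F_2 *)

Section ParityMaps.
Import GRing.Theory.
Local Open Scope ring_scope.
Variables T U : finType.
Implicit Types (A B : {set T}) (f : T -> U).

Lemma overlap_imset f A (B : {set U}) :
  injective f -> overlap (f @: A) B = overlap A (f @^-1: B).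
Proof.
move=> f_inj; rewrite /overlap -(card_imset _ f_inj); congr (odd #|pred_of_set _|).
apply/setP=> y; rewrite inE; apply/andP/imsetP.
  by move=> [/imsetP[x xA ->] fxB]; exists x; rewrite // !inE xA.
by move=> [x + ->]; rewrite !inE => /andP[xA fxB]; rewrite imset_f.
Qed.

Lemma imset_symdiff f A B : injective f ->
  f @: symdiff A B = symdiff (f @: A) (f @: B).
Proof.
move=> f_inj; apply/setP=> y; rewrite in_symdiff.
have [/imsetP[x _ ->]|no] := boolP (y \in f @: setT).
  by rewrite !(mem_imset _ _ f_inj) in_symdiff.
have out C : (y \in f @: C) = false.
  by apply: contraNF no => /imsetP[x _ ->]; rewrite imset_f.
by rewrite !out.
Qed.

Lemma natr2_inj : injective (fun b : bool => b%:R : 'F_2).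
Proof. by case=> [] []. Qed.

(* Over a field, the row space of a matrix is the annihilator of its kernel. *)
Lemma symdiff_span (r : U -> {set T}) (F : {set T}) :
  (forall K, (forall u, ~~ overlap (r u) K) -> ~~ overlap F K) ->
  exists S : {set U}, forall x, (x \in F) = overlap S [set u | x \in r u].
Proof.
move=> orth.
pose row_of (W : {set T}) := \row_(j < #|T|) (enum_val j \in W)%:R : 'rV['F_2]_#|T|.
pose M := \matrix_(i < #|U|) row_of (r (enum_val i)).
(* The columns of [cokermx M] as subsets of [T]. Each overlaps every [r u] evenly, and by [submxE] a
   row lies in the row space of [M] iff it is orthogonal to all of them. *)
pose kset j := [set x | cokermx M (enum_rank x) j == 1].
have dot W j : (row_of W *m cokermx M) 0 j = (overlap W (kset j))%:R.
  rewrite natr_overlap mxE (reindex (@enum_rank T)) /=;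
    last exact/onW_bij/enum_rank_bij.
  apply: eq_bigr => x _; rewrite mxE enum_rankK inE; congr (_ * _).
  by case: (cokermx _ _ _) => [[|[|m]] lt_m]; apply/val_inj.
have /submxP[D defF] : (row_of F <= M)%MS.
  rewrite submxE; apply/eqP/rowP=> j; rewrite dot mxE.
  rewrite (negPf (orth _ _)) // => u; apply/negP=> ov.
  have := congr1 (fun X => (row (enum_rank u) X) 0 j) (mulmx_coker M).
  by rewrite row_mul rowK enum_rankK dot ov !mxE.
(* [D] holds the coefficients of [F] as a combination of the rows [r u], so its support selects the
   rows to add up. *)
exists [set u | D 0 (enum_rank u) == 1] => x; apply: natr2_inj => /=.
have /rowP/(_ (enum_rank x)) := defF; rewrite !mxE enum_rankK => ->.
rewrite natr_overlap (reindex (@enum_rank U)) /=; last exact/onW_bij/enum_rank_bij.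
apply: eq_bigr => u _; rewrite !mxE !enum_rankK !inE; congr (_ * _).
by case: (D _ _) => [[|[|m]] lt_m]; apply/val_inj.
Qed.

End ParityMaps.

(** * Pauli operators *)

Section PauliFacts.
Import GRing.Theory.
Variable Q : finType.
Implicit Types (P R : pauli Q).

Lemma pauli_eq P R : phase P = phase R -> xsupp P = xsupp R ->
  zsupp P = zsupp R -> P = R.
Proof. by case: P R => [? ? ?] [? ? ?] /= -> -> ->. Qed.

Lemma phaseM P R :
  phase (P * R)%g = (phase P + phase R + swap_phase (zsupp P) (xsupp R))%R.
Proof. by []. Qed.

Lemma xsuppM P R : xsupp (P * R)%g = symdiff (xsupp P) (xsupp R).
Proof. by []. Qed.

Lemma zsuppM P R : zsupp (P * R)%g = symdiff (zsupp P) (zsupp R).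
Proof. by []. Qed.

Lemma swap_phase_overlap (b a : {set Q}) :
  swap_phase b a = (if overlap b a then 2 else 0)%R.
Proof.
rewrite /swap_phase /overlap; elim: #|_| => // n IHn.
by rewrite mulnS natrD IHn oddS; case: odd; apply/val_inj.
Qed.

(** The products in the two orders have the same supports, so only their swap phases can differ:
    this is the symplectic criterion. *)
Lemma commuteP P R :
  reflect (commute P R) (overlap (zsupp P) (xsupp R) == overlap (zsupp R) (xsupp P)).
Proof.
apply: (iffP eqP) => [eq_ov|/(congr1 (@phase Q))].
  apply: pauli_eq; last 2 first.
  - by rewrite !xsuppM; apply/setP=> x; rewrite !in_symdiff addbC.
  - by rewrite !zsuppM; apply/setP=> x; rewrite !in_symdiff addbC.
  by rewrite !phaseM !swap_phase_overlap eq_ov [(phase P + _)%R]addrC.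
rewrite !phaseM [(phase P + _)%R]addrC => /addrI.
by rewrite !swap_phase_overlap; case: overlap; case: overlap => // /eqP.
Qed.

Lemma mem_phases_mul (H : {set pauli Q}) P :
  reflect (exists2 T, T \in H & xsupp T = xsupp P /\ zsupp T = zsupp P)
    (P \in phases * H)%g.
Proof.
apply: (iffP mulsgP) => [[c T /imsetP[k _ ->] TH ->]|[T TH [eqx eqz]]].
  by exists T; rewrite // xsuppM zsuppM !symdiff0s.
exists (Pauli (phase P - phase T)%R set0 set0) T => //; first exact: imset_f.
apply: pauli_eq; rewrite ?xsuppM ?zsuppM ?symdiff0s // phaseM /=.
by rewrite swap_phase_overlap overlap0s addr0 subrK.
Qed.

(** In a finite group the generated subgroup consists of products of generators, inverses
    included. *)
Lemma gen_ind (gT : finGroupType) (A : {set gT}) (Pr : gT -> Prop) :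
  Pr 1%g -> (forall x y, Pr x -> Pr y -> Pr (x * y)%g) ->
  (forall x, x \in A -> Pr x) -> forall x, x \in <<A>>%g -> Pr x.
Proof.
move=> P1 PM PA x /gen_prodgP[n [c cA ->]].
by apply: big_ind => // i _; apply: PA.
Qed.

End PauliFacts.

(** * Cuts and boundaries *)

Section GraphFacts.
Variables (V : finType) (G : graph V).
Implicit Types (S : {set V}) (F : {set edge G}).

(** An edge has two ends, so exactly one of them lies in [S] iff an odd number do. Cuts thereby
    become linear in [S]. *)
Lemma in_cut S e : (e \in cut G S) = overlap (ends e) S.
Proof.
have : (#|ends e :&: S| <= 2)%N by rewrite -(card_ends e) subset_leq_card ?subsetIl.
by rewrite inE /overlap; case: #|_| => [|[|[|]]].
Qed.

Lemma in_boundary F v : (v \in boundary F) = overlap F (star G v).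
Proof. by rewrite inE. Qed.

(** Coboundary and boundary are transposes: both sides count, mod 2, the incidences between [S] and
    [F]. *)
Lemma overlap_cut S F : overlap (cut G S) F = overlap S (boundary F).
Proof.
rewrite !overlapE; under eq_bigr do rewrite in_cut overlapE big_distrl /=.
rewrite exchange_big /=; apply: eq_bigr => v _.
rewrite in_boundary overlapE big_distrr /=; apply: eq_bigr => e _.
by rewrite inE; case: (v \in S); rewrite ?andbF // andbT andbC.
Qed.

Lemma cut_symdiff S S' : cut G (symdiff S S') = symdiff (cut G S) (cut G S').
Proof. by apply/setP=> e; rewrite in_symdiff !in_cut overlap_symdiffr. Qed.

Lemma cut1 v : cut G [set v] = star G v.
Proof. by apply/setP=> e; rewrite in_cut overlapC overlap1s inE. Qed.

Lemma cut0 : cut G set0 = set0.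
Proof. by apply/setP=> e; rewrite in_cut overlaps0 inE. Qed.

Lemma cutC S : cut G (~: S) = cut G S.
Proof.
have -> : ~: S = symdiff S setT by apply/setP=> v; rewrite !inE addbT.
rewrite cut_symdiff; apply/setP=> e; rewrite in_symdiff [_ \in cut G setT]in_cut.
by rewrite /overlap setIT card_ends addbF.
Qed.

Lemma boundary_symdiff F F' :
  boundary (symdiff F F') = symdiff (boundary F) (boundary F').
Proof. by apply/setP=> v; rewrite in_symdiff !in_boundary overlap_symdiffl. Qed.

Lemma boundary0 : boundary (set0 : {set edge G}) = set0.
Proof. by apply/setP=> v; rewrite in_boundary overlap0s inE. Qed.

(** A set with empty cut is closed under adjacency, hence a union of connected components. *)
Lemma cut_eq0 S : connected G -> cut G S = set0 -> S = set0 \/ S = setT.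
Proof.
move=> conn cutS0.
have adjS v w : adjacent G v w -> v \in S -> w \in S.
  case/existsP=> e /andP[ve we] vS; have := in_cut S e; rewrite cutS0 inE /overlap.
  move=> ev; suff /setIidPl/subsetP -> : ends e :&: S = ends e by [].
  apply/eqP; rewrite eqEcard subsetIl card_ends.
  have : (0 < #|ends e :&: S|)%N by apply/card_gt0P; exists v; rewrite inE ve.
  by case: #|_| ev => [|[]].
have clS : closed (adjacent G) [in S].
  move=> v w vw; apply/idP/idP; apply: adjS => //.
  by case/existsP: vw => e vw; apply/existsP; exists e; rewrite andbC.
have [->|[v vS]] := set_0Vmem S; [by left | right].
by apply/setP=> w; rewrite inE -(closed_connect clS (conn v w)).
Qed.

(** An edge set overlapping every star evenly is a cycle, hence a sum of generators, so [F]
    annihilates the kernel of the incidence matrix and is a sum of stars by [symdiff_span]. *)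
Lemma cocycle_is_cut (B : {set {set edge G}}) F : generates_cycles B ->
  (forall p, p \in B -> ~~ overlap F p) -> exists S, F = cut G S.
Proof.
move=> [_ genB] FB.
have [K Kcyc|S defF] := @symdiff_span _ _ (star G) F.
  have /genB[J /subsetP sJB ->] : is_cycle K.
    by apply/eqP/setP=> v; rewrite in_boundary overlapC (negPf (Kcyc v)) inE.
  apply: (big_ind (fun W => ~~ overlap F W)) => [|p q Fp Fq|p /sJB/FB //].
    by rewrite overlaps0.
  by rewrite overlap_symdiffr (negPf Fp).
exists S; apply/setP=> e; rewrite defF in_cut overlapC; congr overlap.
by apply/setP=> v; rewrite !inE.
Qed.

End GraphFacts.

(** * Vertices and the qubits they carry *)

Section RealVertices.
Variables (Q D : finType) (A : {set Q}).
Implicit Types (S : {set vertices A D}) (B : {set Q}).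

(** This is the X part on the original qubits of the product of the [A_v] over [S]; dummies
    contribute nothing. *)
Definition qubits_in S : {set Q} := val @: (inl @^-1: S).

(** [qubits_in] and [real_vertices] are transposes of each other. *)
Lemma overlap_qubits_in S B :
  overlap (qubits_in S) B = overlap S (real_vertices A D B).
Proof.
have -> : real_vertices A D B = inl @: (val @^-1: B).
  apply/setP=> -[u|d]; rewrite [LHS]inE ?(mem_imset _ _ inl_inj) ?inE //.
  by apply/esym/imsetP=> -[].
rewrite overlap_imset; last exact: val_inj.
rewrite (overlapC _ S) overlap_imset; last exact: inl_inj.
exact: overlapC.
Qed.

Lemma qubits_in_symdiff S S' :
  qubits_in (symdiff S S') = symdiff (qubits_in S) (qubits_in S').
Proof.
have preimD : inl @^-1: symdiff S S' = symdiff (inl @^-1: S) (inl @^-1: S').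
  by apply/setP=> u; rewrite !inE.
rewrite /qubits_in preimD imset_symdiff //; exact: val_inj.
Qed.

Lemma qubits_in0 : qubits_in set0 = set0.
Proof. by rewrite /qubits_in preimset0 imset0. Qed.

Lemma qubits_inT : qubits_in setT = A.
Proof.
apply/setP=> q; apply/imsetP/idP => [[u _ ->]|qA]; first exact: valP.
by exists (exist _ q qA); rewrite ?inE.
Qed.

Lemma real_vertices_symdiff B B' :
  real_vertices A D (symdiff B B') =
  symdiff (real_vertices A D B) (real_vertices A D B').
Proof. by apply/setP=> -[u|d]; rewrite !inE. Qed.

Lemma real_vertices0 : real_vertices A D set0 = set0.
Proof. by apply/setP=> -[u|d]; rewrite !inE. Qed.

Lemma card_qubits_in S : (#|qubits_in S| <= #|S|)%N.
Proof.
rewrite (card_imset _ val_inj) -(card_imset _ (@inl_inj _ D)).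
by apply: subset_leq_card; apply/subsetP=> _ /imsetP[u uS ->]; rewrite inE in uS.
Qed.

End RealVertices.
Arguments qubits_in {Q D A} S.

(** * The deformed stabilizer group *)

Section DeformedStabilizer.
Variables (C : pauli_code) (g : gauging C).
Let Q := qubit C.
Let V : finType := vertices (lsupp g) (dummy g).
Let E : finType := edge (aux g).
Implicit Types (a b : {set Q}) (F : {set E}) (S : {set V}) (T : pauli Q).
Local Notation real := (real_vertices (lsupp g) (dummy g)).
Local Notation stabC := (<<checks C>>%g).
Local Notation stabD := (<<checks (deformed g)>>%g).

(** The two images are disjoint, so this is their union; as a symmetric difference it falls under
    the additivity of [overlap]. *)
Definition join_sets a F : {set deformed_qubit g} :=
  symdiff (inl @: a) (inr @: F).

Lemma preimset_inl_join a F : inl @^-1: join_sets a F = a.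
Proof.
apply/setP=> q; rewrite inE in_symdiff (mem_imset _ _ inl_inj).
by rewrite [X in _ (+) X](_ : _ = false) ?addbF //; apply/imsetP=> -[].
Qed.

Lemma preimset_inr_join a F : inr @^-1: join_sets a F = F.
Proof.
apply/setP=> e; rewrite inE in_symdiff (mem_imset _ _ inr_inj).
by rewrite [X in X (+) _](_ : _ = false) //; apply/imsetP=> -[].
Qed.

Lemma in_join_sets a F x :
  (x \in join_sets a F) = match x with inl q => q \in a | inr e => e \in F end.
Proof.
case: x => [q|e].
  by have /setP/(_ q) := preimset_inl_join a F; rewrite inE.
by have /setP/(_ e) := preimset_inr_join a F; rewrite inE.
Qed.

Lemma join_setsE (W : {set deformed_qubit g}) :
  W = join_sets (inl @^-1: W) (inr @^-1: W).
Proof. by apply/setP=> -[q|e]; rewrite in_join_sets inE. Qed.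

Lemma join_sets_inj a F a' F' :
  join_sets a F = join_sets a' F' -> a = a' /\ F = F'.
Proof.
move=> eqW; split.
  by rewrite -(preimset_inl_join a F) eqW preimset_inl_join.
by rewrite -(preimset_inr_join a F) eqW preimset_inr_join.
Qed.

Lemma join_sets0 : join_sets set0 set0 = set0.
Proof. by apply/setP=> -[q|e]; rewrite in_join_sets !inE. Qed.

Lemma symdiff_join_sets a F a' F' :
  symdiff (join_sets a F) (join_sets a' F') =
  join_sets (symdiff a a') (symdiff F F').
Proof. by apply/setP=> -[q|e]; rewrite in_symdiff !in_join_sets in_symdiff. Qed.

Lemma overlap_join_sets a F a' F' :
  overlap (join_sets a F) (join_sets a' F') = overlap a a' (+) overlap F F'.
Proof.
rewrite overlap_symdiffl !overlap_imset; [|exact: inr_inj|exact: inl_inj].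
by rewrite preimset_inl_join preimset_inr_join.
Qed.

Lemma card_join_sets a F : #|join_sets a F| = (#|a| + #|F|)%N.
Proof.
rewrite -sum1_card big_mkcond /= big_sumType /= -!sum1_card.
congr (_ + _)%N; rewrite [RHS]big_mkcond; apply: eq_bigr => x _;
  by rewrite in_join_sets.
Qed.

(* The product of the [A_v] over [S], of checks of [C] multiplying to [T], and
   of [Z_e] over [F]; the signs of the [A_v] are part of the phase. *)
Definition deformed_op S T F : pauli (deformed_qubit g) :=
  Pauli (phase (sgn (overlap S [set v | outcome v]) : pauli Q) + phase T)%R
    (join_sets (symdiff (qubits_in S) (xsupp T)) (cut (aux g) S))
    (join_sets (zsupp T) F).

Lemma xsupp_deformed_op S T F :
  xsupp (deformed_op S T F) =
  join_sets (symdiff (qubits_in S) (xsupp T)) (cut (aux g) S).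
Proof. by []. Qed.

Lemma zsupp_deformed_op S T F :
  zsupp (deformed_op S T F) = join_sets (zsupp T) F.
Proof. by []. Qed.

Lemma phase_deformed_op S T F :
  phase (deformed_op S T F) =
  (phase (sgn (overlap S [set v | outcome v]) : pauli Q) + phase T)%R.
Proof. by []. Qed.

Lemma phase_sgn_addb (R : finType) s t :
  phase (sgn (s (+) t) : pauli R) =
  (phase (sgn s : pauli R) + phase (sgn t : pauli R))%R.
Proof. by case: s t => [] []; apply/val_inj. Qed.

(* The Z part of [T] meets the X part of [A_v] on the qubit [v] iff [F] meets it
   on an odd number of edges. *)
Lemma overlap_deformed_op S T F S' T' F' : boundary F = real (zsupp T) ->
  overlap (zsupp (deformed_op S T F)) (xsupp (deformed_op S' T' F')) =
  overlap (zsupp T) (xsupp T').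
Proof.
move=> bF; rewrite zsupp_deformed_op xsupp_deformed_op overlap_join_sets.
rewrite (overlapC _ F) overlap_cut bF overlap_symdiffr.
by rewrite (overlapC _ (zsupp T)) overlap_qubits_in addbAC addbb.
Qed.

(** By [overlap_deformed_op] the reordering sign is exactly that of [T] and [T'], so these operators
    multiply componentwise. *)
Lemma deformed_opM S T F S' T' F' : boundary F = real (zsupp T) ->
  (deformed_op S T F * deformed_op S' T' F')%g =
  deformed_op (symdiff S S') (T * T')%g (symdiff F F').
Proof.
move=> bF; apply: pauli_eq.
- rewrite phaseM swap_phase_overlap overlap_deformed_op // -swap_phase_overlap.
  rewrite !phase_deformed_op overlap_symdiffl phase_sgn_addb phaseM.
  by rewrite GRing.addrACA !GRing.addrA.
- rewrite xsuppM !xsupp_deformed_op symdiff_join_sets -cut_symdiff.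
  rewrite qubits_in_symdiff xsuppM; congr join_sets; apply/setP=> q.
  by rewrite !in_symdiff addbACA.
by rewrite zsuppM !zsupp_deformed_op symdiff_join_sets.
Qed.

Lemma commute_deformed_op S T F S' T' F' :
  boundary F = real (zsupp T) -> boundary F' = real (zsupp T') ->
  commute T T' -> commute (deformed_op S T F) (deformed_op S' T' F').
Proof.
move=> bF bF' /commuteP cTT'; apply/commuteP.
by rewrite !overlap_deformed_op.
Qed.

Lemma vertex_checkE v : vertex_check v = deformed_op [set v] 1%g set0.
Proof.
apply: pauli_eq.
- rewrite phase_deformed_op overlap1s inE phaseM swap_phase_overlap overlap0s.
  by case: v => [u|d] /=; rewrite !GRing.addr0.
- rewrite xsupp_deformed_op cut1 xsuppM symdiff0s /qubits_in.
  apply/setP=> -[q|e]; rewrite in_join_sets ?in_symdiff.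
    rewrite [q \in xsupp _]inE addbF; case: v => [u|d] /=.
      rewrite !inE (_ : (_ \in imset _ _) = false) ?orbF; last by apply/imsetP=> -[].
      apply/eqP/imsetP => [[->]|[w]]; first by exists u; rewrite ?inE.
      by rewrite !inE => /eqP[->] ->.
    by apply/imsetP/imsetP=> -[w] //; rewrite !inE.
  by case: v => [u|d] /=; rewrite ?in_setU1 /= (mem_imset _ _ inr_inj).
rewrite zsupp_deformed_op zsuppM join_sets0.
by case: v => [u|d]; rewrite symdiffss.
Qed.

Lemma cycle_checkE p : cycle_check p = deformed_op set0 1%g p.
Proof.
apply: pauli_eq.
- by rewrite phase_deformed_op overlap0s /= GRing.addr0.
- by rewrite xsupp_deformed_op cut0 qubits_in0 symdiff0s join_sets0.
by rewrite zsupp_deformed_op /join_sets imset0 symdiff0s.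
Qed.

Lemma matched_checkE j : matched_check g j = deformed_op set0 (check j) (matching g j).
Proof.
apply: pauli_eq.
- rewrite phase_deformed_op overlap0s phaseM swap_phase_overlap overlaps0.
  by rewrite /= !GRing.addr0 GRing.add0r.
- rewrite xsupp_deformed_op cut0 qubits_in0 symdiff0s xsuppM /join_sets.
  by rewrite imset0.
by rewrite zsupp_deformed_op zsuppM.
Qed.

Lemma boundary0_real1 : boundary (set0 : {set E}) = real (zsupp (1%g : pauli Q)).
Proof. by rewrite boundary0 real_vertices0. Qed.

(** Restricting [T] to 1 or a single check reduces commutation of the deformed checks to that of the
    original ones. *)
Lemma deformed_checkE (c : check_idx (deformed g)) :
  exists S T F, [/\ T = 1%g \/ T \in checks C, boundary F = real (zsupp T) &
    check c = deformed_op S T F].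
Proof.
case: c => [[v|p]|j] /=.
- exists [set v], 1%g, set0; split.
  + by left.
  + exact: boundary0_real1.
  exact: vertex_checkE.
- exists set0, 1%g, (val p); split; [by left| |exact: cycle_checkE].
  rewrite -boundary0_real1 boundary0; have [cyc _] := cycles_generate g.
  exact/eqP/cyc/valP.
exists set0, (check j), (matching g j); split.
- by right; apply: imset_f.
- exact: matching_boundary.
exact: matched_checkE.
Qed.

(** The boundary condition is linear in [F] and [zsupp T], so it passes from the checks to their
    products. *)
Lemma deformed_stab_op (P : pauli (deformed_qubit g)) : P \in stabD ->
  exists S T F, [/\ T \in stabC, boundary F = real (zsupp T) & P = deformed_op S T F].
Proof.
move: P; apply: gen_ind => [|P1 P2|_ /imsetP[c _ ->]].
- exists set0, 1%g, set0; split; [exact: group1|exact: boundary0_real1|].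
  rewrite -cycle_checkE /cycle_check; congr Pauli.
  by rewrite (_ : [set _ | _ in _] = set0) // imset0.
- move=> [S1 [T1 [F1 [sT1 b1 ->]]]] [S2 [T2 [F2 [sT2 b2 ->]]]].
  exists (symdiff S1 S2), (T1 * T2)%g, (symdiff F1 F2); split.
  + exact: groupM.
  + by rewrite boundary_symdiff b1 b2 zsuppM real_vertices_symdiff.
  exact: deformed_opM.
have [S [T [F [sT bF ->]]]] := deformed_checkE c.
exists S, T, F; split=> //; case: sT => [->|sT]; [exact: group1|exact: mem_gen].
Qed.

Lemma op_deformed_stab S T F : T \in stabC -> boundary F = real (zsupp T) ->
  deformed_op S T F \in stabD.
Proof.
have gen c : check c \in stabD by apply: mem_gen; apply: imset_f.
have op0 : deformed_op set0 1%g set0 = 1%g.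
  by rewrite -cycle_checkE /cycle_check imset0.
have vert U : deformed_op U 1%g set0 \in stabD.
  elim: {U}#|U| {-2}U (erefl #|U|) => [|n IHn] U.
    by move/eqP; rewrite cards_eq0 => /eqP->; rewrite op0 group1.
  move=> cardU; have [v vU] : exists v, v \in U by apply/card_gt0P; rewrite cardU.
  have -> : U = symdiff [set v] (U :\ v).
    by apply/setP=> w; rewrite !inE; case: eqP => // ->; rewrite vU.
  rewrite -[1%g]mulg1 -[X in deformed_op _ _ X](symdiffss set0).
  rewrite -deformed_opM ?boundary0_real1 // groupM //.
    by rewrite -vertex_checkE (gen (inl (inl v))).
  by apply: IHn; rewrite (cardsD1 v) vU in cardU; case: cardU.
have cyc W : boundary W = set0 -> deformed_op set0 1%g W \in stabD.
  have [cyc genB] := cycles_generate g.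
  move/eqP/genB=> [J /subsetP sJ ->].
  suff [] : boundary (\big[@symdiff E/set0]_(p in J) p) = set0 /\
     deformed_op set0 1%g (\big[@symdiff E/set0]_(p in J) p) \in stabD by [].
  apply: (big_ind (fun W => boundary W = set0 /\ deformed_op set0 1%g W \in stabD)).
  - by rewrite boundary0 op0 group1.
  - move=> p q [bp sp] [bq sq]; rewrite boundary_symdiff bp bq symdiffss.
    split=> //; rewrite -[1%g]mulg1 -[X in deformed_op X](symdiffss set0).
    rewrite -deformed_opM; first exact: groupM.
    by rewrite bp -boundary0_real1 boundary0.
  move=> p /sJ pB; split; first exact/eqP/cyc.
  by rewrite -cycle_checkE (gen (inl (inr (exist _ p pB)))).
move=> sT bF.
(* Multiplying the matched checks that make up [T] gives some admissible edge set [F'], possibly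
   different from [F]. *)
have [F' bF' sT'] : exists2 F', boundary F' = real (zsupp T) &
    deformed_op set0 T F' \in stabD.
  move: T sT {bF}; apply: gen_ind => [|T1 T2|_ /imsetP[j _ ->]].
  - by exists set0; [exact: boundary0_real1|rewrite op0 group1].
  - move=> [F1 b1 s1] [F2 b2 s2]; exists (symdiff F1 F2).
      by rewrite boundary_symdiff b1 b2 zsuppM real_vertices_symdiff.
    rewrite -[X in deformed_op X](symdiffss set0) -deformed_opM //; exact: groupM.
  exists (matching g j); first exact: matching_boundary.
  by rewrite -matched_checkE (gen (inr j)).
(* [F] and [F'] have equal boundaries, so they differ by a cycle, which the cycle checks supply. *)
have bFF' : boundary (symdiff F F') = set0 by rewrite boundary_symdiff bF bF' symdiffss.
have eqS : symdiff S (symdiff set0 set0) = S.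
  by apply/setP=> v; rewrite !in_symdiff !inE !addbF.
have eqF : symdiff set0 (symdiff (symdiff F F') F') = F.
  by rewrite symdiff0s; apply/setP=> e; rewrite !in_symdiff addbK.
have b1 : boundary (symdiff F F') = real (zsupp (1%g : pauli Q)).
  by rewrite bFF' -boundary0_real1 boundary0.
have := groupM (vert S) (groupM (cyc _ bFF') sT').
rewrite (deformed_opM _ _ _ _ _ _ b1) (deformed_opM _ _ _ _ _ _ boundary0_real1).
by rewrite eqS eqF 2!mul1g.
Qed.

(** If -1 were generated, its vertex set [S] would have empty cut. By connectedness [S] is empty,
    which puts -1 in the original group, or everything, which puts there the signed L excluded by
    [outcome_possible]. *)
Lemma deformed_is_stabilizer : is_stabilizer_code C ->
  is_stabilizer_code (deformed g).
Proof.
move=> [commC stabN1]; split=> [c d|].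
  have [S [T [F [sT bF ->]]]] := deformed_checkE c.
  have [S' [T' [F' [sT' bF' ->]]]] := deformed_checkE d.
  apply: commute_deformed_op => //.
  case: sT => [->|/imsetP[j _ ->]]; first by rewrite /commute mul1g mulg1.
  case: sT' => [->|/imsetP[k _ ->]]; first by rewrite /commute mul1g mulg1.
  exact: commC.
apply/negP=> /deformed_stab_op[S [T [F [sT bF]]]] eqP.
have /esym/join_sets_inj[xT cutS] : join_sets set0 set0 = xsupp (deformed_op S T F).
  by rewrite join_sets0 -eqP.
have /esym/join_sets_inj[zT _] : join_sets set0 set0 = zsupp (deformed_op S T F).
  by rewrite join_sets0 -eqP.
have := congr1 (@phase _) eqP; rewrite phase_deformed_op => phT.
have {}xT : xsupp T = qubits_in S.
  by rewrite -[LHS]symdiff0s -(symdiffss (qubits_in S)) -symdiffA xT;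
    apply/setP=> q; rewrite !inE addbF.
have [S0|ST] := cut_eq0 _ _ _ (@aux_connected C g) cutS.
  case/negP: stabN1; rewrite (_ : sgn true = T) //; apply: pauli_eq => //=.
  - by move: phT; rewrite S0 overlap0s /= GRing.add0r.
  - by rewrite xT S0 qubits_in0.
case/negP: (@outcome_possible C g).
rewrite (_ : (_ * _)%g = T) //.
apply: pauli_eq; last by rewrite zsuppM symdiff0s.
  2: by rewrite xsuppM symdiff0s xT ST qubits_inT.
(* With s the parity of the -1 outcomes, [phT] reads 2 = 2s + [phase T] mod 4, so [T] carries the
   sign of [~~ s]. *)
rewrite phaseM swap_phase_overlap overlap0s !GRing.addr0.
move: phT; rewrite ST overlapE.
under eq_bigr do rewrite !inE /=.
case: (\big[_/_]_v _) => /=; last by rewrite GRing.add0r.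
by rewrite -[LHS]GRing.addr0 => /GRing.addrI.
Qed.

End DeformedStabilizer.

(** * Distance *)

Section Expansion.
Import Order.TTheory GRing.Theory Num.Theory.
Variables (V : finType) (G : graph V).

(** A set and its complement share their cut, and one of them has at most half of the vertices. *)
Lemma small_side (S : {set V}) : (1 <= cheeger G)%E ->
  exists2 S' : {set V}, cut G S' = cut G S & (#|S'| <= #|cut G S'|)%N.
Proof.
move=> /bigmin_geP[_ hG].
have small (S' : {set V}) : (2 * #|S'| <= #|V|)%N -> (#|S'| <= #|cut G S'|)%N.
  (* The empty set is not a candidate in the minimum, but satisfies the bound trivially. *)
  move=> le_S'; have [->//|S'0] := posnP #|S'|.
  have := hG S'; rewrite S'0 le_S' => /(_ isT).
  by rewrite lee_fin ler_pdivlMr ?ltr0n // mul1r ler_nat.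
have [le_S|/ltnW le_S] := leqP (2 * #|S|) #|V|; first by exists S; rewrite ?small.
exists (~: S); rewrite ?small ?cutC //.
by move: le_S; rewrite -(cardsC S) !mul2n -!addnn leq_add2l leq_add2r.
Qed.

End Expansion.

Section DeformedDistance.
Import Order.TTheory.
Variables (C : pauli_code) (g : gauging C).
Local Notation real := (real_vertices (lsupp g) (dummy g)).

Lemma nontrivial_logical_descends (P : pauli (qubit (deformed g))) :
  (1 <= cheeger (aux g))%E -> nontrivial_logical P ->
  exists2 P0 : pauli (qubit C), nontrivial_logical P0 & (weight P0 <= weight P)%N.
Proof.
move=> expanding /andP[/centP centrP /mem_phases_mul nontrivP].
pose a : {set qubit C} := inl @^-1: xsupp P.
pose b : {set qubit C} := inl @^-1: zsupp P.
pose X : {set edge (aux g)} := inr @^-1: xsupp P.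
pose F : {set edge (aux g)} := inr @^-1: zsupp P.
have xP : xsupp P = join_sets C g a X by apply: join_setsE.
have zP : zsupp P = join_sets C g b F by apply: join_setsE.
have comm S T F' : deformed_op C g S T F' \in checks (deformed g) ->
    overlap b (symdiff (qubits_in S) (xsupp T)) (+) overlap F (cut (aux g) S) =
    overlap (zsupp T) a (+) overlap F' X.
  move=> opD; have /commuteP/eqP := centrP _ opD.
  by rewrite zP xP xsupp_deformed_op zsupp_deformed_op !overlap_join_sets.
have chk c : check c \in checks (deformed g) by apply: imset_f.
(* Commuting with every [B_p] makes [X] a cocycle. *)
have [S0 XS0] : exists S, X = cut (aux g) S.
  apply: (cocycle_is_cut _ _ _ _ (@cycles_generate C g)) => p pB.
  have := chk (inl (inr (exist _ p pB))); rewrite /= cycle_checkE => /comm.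
  by rewrite qubits_in0 symdiffss cut0 !overlaps0 overlap0s overlapC /= => <-.
have [S cutS leS] := small_side _ (aux g) S0 expanding.
have {XS0}XS : X = cut (aux g) S by rewrite cutS.
(* Commuting with [A_v] says that [F] meets the star of [v] oddly iff [v] carries a qubit of [b]. *)
have bF : boundary F = real b.
  apply/setP=> v; have := chk (inl (inl v)); rewrite /= vertex_checkE => /comm.
  rewrite overlap_symdiffr overlaps0 addbF cut1 !overlap0s -in_boundary.
  rewrite overlapC overlap_qubits_in overlap1s.
  by do 2!case: (v \in _).
(* The original-qubit part of [P] times the [A_v] over [S]; its phase is immaterial. *)
exists (Pauli 0%R (symdiff (qubits_in S) a) b); last first.
  have cardP : weight P = (#|a :|: b| + #|X :|: F|)%N.
    rewrite -card_join_sets /weight; congr #|pred_of_set _|.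
    by apply/setP=> -[q|e]; rewrite in_join_sets !inE.
  rewrite cardP /weight /supp /=.
  (* At most #|S| qubits are gained, and #|S| is at most the size of the cut [X] cleared from the
     edges. *)
  apply: (@leq_trans #|(a :|: b) :|: qubits_in S|).
    apply: subset_leq_card; apply/subsetP=> q; rewrite !(in_setU, in_symdiff).
    by case: (q \in a); case: (q \in b); case: (q \in _).
  apply: (leq_trans (leq_card_setU _ _)); rewrite leq_add2l.
  apply: (leq_trans (card_qubits_in _ _ _ S)); apply: (leq_trans leS).
  by rewrite -XS subset_leq_card ?subsetUl.
apply/andP; split.
  apply/centP=> _ /imsetP[j _ ->]; apply/commuteP => /=.
  have := chk (inr j); rewrite /= matched_checkE => /comm.
  rewrite qubits_in0 symdiff0s cut0 overlaps0 addbF => ->.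
  (* The overlap of the matching with the cut equals that of [qubits_in S] with the Z part of the
     check, by transposing twice. *)
  rewrite overlap_symdiffr XS (overlapC _ (matching g j)) overlap_cut.
  rewrite matching_boundary -overlap_qubits_in.
  by rewrite (overlapC _ (zsupp _) (qubits_in S)) addbC.
(* A stabilizer [T] with the supports of the descended operator lifts to one with the supports of
   [P]; [bF] makes [F] admissible for it. *)
apply/mem_phases_mul => -[T stabT [/= xT zT]]; apply: nontrivP.
exists (deformed_op C g S T F).
  by apply: op_deformed_stab; rewrite // zT.
rewrite xsupp_deformed_op zsupp_deformed_op xT zT xP zP XS symdiffA symdiffss.
by rewrite symdiff0s.
Qed.

Lemma distance_deformed : (1 <= cheeger (aux g))%E ->
  (distance C <= distance (deformed g))%E.
Proof.
(* The first conjunct compares with the default +oo, the distance in the absence of nontrivial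
   logical operators. *)
move=> expanding; apply/bigmin_geP; split=> [|P ntP]; first exact: bigmin_le_id.
have [P0 ntP0 leP0] := nontrivial_logical_descends P expanding ntP.
by apply: (bigmin_inf P0); rewrite // lee_fin Num.Theory.ler_nat.
Qed.

End DeformedDistance.

(** * Sparsity *)

Section DeformedSparsity.
Variables (C : pauli_code) (g : gauging C).
Local Notation Q := (qubit C).
Local Notation E := (edge (aux g)).

(** A single bound for all three kinds of checks, each of which leaves some of the terms zero. *)
Lemma weight_deformed_op S T F :
  (weight (deformed_op C g S T F) <=
   #|S| + weight T + (#|cut (aux g) S| + #|F|))%N.
Proof.
have -> : weight (deformed_op C g S T F) =
    (#|symdiff (qubits_in S) (xsupp T) :|: zsupp T| + #|cut (aux g) S :|: F|)%N.
  rewrite -card_join_sets /weight; congr #|pred_of_set _|.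
  by apply/setP=> -[q|e]; rewrite in_join_sets !(in_setU, in_join_sets).
apply: leq_add; last exact: leq_card_setU.
apply: (@leq_trans #|qubits_in S :|: supp T|).
  apply: subset_leq_card; apply/subsetP=> q; rewrite !inE.
  by case: (q \in qubits_in S); case: (_ \in _).
apply: (leq_trans (leq_card_setU _ _)); rewrite leq_add2r; exact: card_qubits_in.
Qed.

Lemma supp_deformed_op S T F x :
  (x \in supp (deformed_op C g S T F)) =
  match x with
  | inl q => (q \in symdiff (qubits_in S) (xsupp T)) || (q \in zsupp T)
  | inr e => (e \in cut (aux g) S) || (e \in F)
  end.
Proof. by case: x => [q|e]; rewrite in_setU !in_join_sets. Qed.

Lemma card_checks_on_deformed x (B : {set vertices (lsupp g) (dummy g)})
    (P : {set {set E}}) (J : {set check_idx C}) :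
  (forall v, x \in supp (vertex_check v) -> v \in B) ->
  (forall p, p \in cycles g -> x \in supp (cycle_check p) -> p \in P) ->
  (forall j, x \in supp (matched_check g j) -> j \in J) ->
  (#|@checks_on (deformed g) x| <= #|B| + #|P| + #|J|)%N.
Proof.
move=> inB inP inJ; pose P' : {set {p | p \in cycles g}} := val @^-1: P.
have P'P : (#|P'| <= #|P|)%N.
  rewrite -(card_imset _ val_inj); apply: subset_leq_card.
  by apply/subsetP=> _ /imsetP[p pP' ->]; rewrite inE in pP'.
apply: (@leq_trans #|[set inl (inl v) | v in B] :|: [set inl (inr p) | p in P']
                     :|: [set inr j | j in J]|); last first.
  apply: (leq_trans (leq_card_setU _ _)); apply: leq_add; last exact: leq_imset_card.
  apply: (leq_trans (leq_card_setU _ _)); apply: leq_add; first exact: leq_imset_card.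
  exact: leq_trans (leq_imset_card _ _) P'P.
apply: subset_leq_card; apply/subsetP=> -[[v|p]|j]; rewrite !in_setU inE /=.
- by move/inB=> vB; rewrite (imset_f (fun v => inl (inl v))).
- move/(inP _ (valP p)) => pP.
  by rewrite (imset_f (fun p => inl (inr p))) ?orbT // inE.
by move/inJ=> jJ; rewrite (imset_f inr) ?orbT.
Qed.

(** The 2 counts the ends of an edge, whose [A_v] act on its qubit; it also covers the single qubit
    of an [A_v] and the single vertex at an original qubit. *)
Lemma deformed_sparsity (K KG KM KC : nat) :
  (forall j : check_idx C, (weight (check j) <= K)%N) ->
  (forall q : qubit C, (#|checks_on q| <= K)%N) ->
  (forall v, (#|star (aux g) v| <= KG)%N) ->
  (forall j, (#|matching g j| <= KM)%N) ->
  (forall e, (#|[set j | e \in matching g j]| <= KM)%N) ->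
  (forall p, p \in cycles g -> (#|p| <= KC)%N) ->
  (forall e, (#|[set p in cycles g | e \in p]| <= KC)%N) ->
  (forall c : check_idx (deformed g), (weight (check c) <= 2 + K + KG + KM + KC)%N) /\
  (forall x : qubit (deformed g), (#|checks_on x| <= 2 + K + KG + KM + KC)%N).
Proof.
move=> wK onK degK mK onM cK onC; split.
  have w1 : weight (1%g : pauli Q) = 0%N by rewrite /weight /supp setU0 cards0.
  case=> [[v|[p pB]]|j] /=.
  - rewrite vertex_checkE; apply: (leq_trans (weight_deformed_op _ _ _)).
    rewrite cards1 w1 cards0 cut1; have := degK v; lia.
  - rewrite cycle_checkE; apply: (leq_trans (weight_deformed_op _ _ _)).
    rewrite cards0 w1 cut0 cards0; have := cK p pB; lia.
  rewrite matched_checkE; apply: (leq_trans (weight_deformed_op _ _ _)).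
  rewrite cut0 !cards0; have := mK j; have := wK j; lia.
case=> [q|e].
  have := @card_checks_on_deformed (inl q)
    [set v | if v is inl u then val u == q else false] set0 (checks_on q).
  (* Vertices carrying the same qubit coincide, and dummies carry none. *)
  set B := [set v | _]; have B1 : (#|B| <= 1)%N.
    apply/card_le1_eqP=> -[u|d] [u'|d']; rewrite !inE //.
    by move=> /eqP uq /eqP u'q; congr inl; apply: val_inj; rewrite /= uq u'q.
  rewrite cards0 => le_on; apply: leq_trans (le_on _ _ _) _.
  - move=> v; rewrite vertex_checkE supp_deformed_op in_symdiff !inE !orbF addbF.
    by case/imsetP=> u; rewrite !inE => /eqP <- ->.
  - by move=> p _; rewrite cycle_checkE supp_deformed_op qubits_in0 symdiffss !inE.
  - by move=> j; rewrite matched_checkE supp_deformed_op qubits_in0 symdiff0s !inE.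
  rewrite addn0; apply: (leq_trans (leq_add B1 (onK q))); lia.
have := @card_checks_on_deformed (inr e) (ends e)
  [set p in cycles g | e \in p] [set j | e \in matching g j].
move=> le_on; apply: leq_trans (le_on _ _ _) _.
- by move=> v; rewrite vertex_checkE supp_deformed_op cut1 !inE orbF.
- by move=> p pB; rewrite cycle_checkE supp_deformed_op cut0 !inE pB.
- by move=> j; rewrite matched_checkE supp_deformed_op cut0 !inE.
rewrite card_ends; have := onM e; have := onC e; lia.
Qed.

End DeformedSparsity.

Theorem theorem2 (I : Type) (C : I -> pauli_code)
    (g : forall i : I, gauging (C i))
    (C_qLDPC : LDPC C)
    (sparse : constant_degree g)
    (matchings : constant_matchings g)
    (short_cycles : constant_cycles g)
    (expanding : forall i : I, (1 <= cheeger (aux (g i)))%E) :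
  suitable g.
Proof.
case: C_qLDPC sparse matchings short_cycles => stabC [K wK] [KG degK] [KM mK] [KC cK].
split=> [i| |i]; first exact: aux_connected; last exact: distance_deformed.
split=> [i|]; first exact: deformed_is_stabilizer.
exists (2 + K + KG + KM + KC)%N => i.
have [[? ?] [? ?] [? ?]] := And3 (wK i) (mK i) (cK i).
exact: deformed_sparsity.
Qed.
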